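(* Let $T$ be a positive theory with the Joint Continuation Property, and let $\varphi(x;y)$ and $\psi(x;y)$ be mutually contradictory positive formulas. Then $\varphi(x;y)$ has $\mathsf{IP}$ witnessed by $\psi(x;y)$ if and only if $\operatorname{alt}(\varphi,\psi)=\infty$. Moreover, if these equivalent conditions hold, then there are an indiscernible sequence $(a_i)_{i<\omega}$ and a tuple $b$ such that $\operatorname{alt}(\varphi,\psi,(a_i),b)=\infty$.
   Context: Positive logic: a positive formula is one built from atomic formulas (including equalities) using $\wedge,\vee,\top,\bot,\exists$. An h-inductive sentence is $\forall x\,(\varphi(x)\to\psi(x))$ with $\varphi,\psi$ positive; a positive theory is a consistent set of h-inductive sentences. A homomorphism is a map preserving positive formulas; an immersion is a homomorphism that also reflects positive formulas. A model $M\models T$ is pec (positively existentially closed) if every homomorphism from $M$ to a model of $T$ is an immersion. $T$ has the Joint Continuation Property if any two models of $T$ admit homomorphisms into a common model of $T$. We work in a monster model $\mathfrak U$ of $T$: for a sufficiently large cardinal $\bar\kappa$ (''small'' means of size $<\bar\kappa$), $\mathfrak U$ is a pec model such that every partial immersion $\mathfrak U\to\mathfrak U$ with small domain extends to an automorphism, and every small finitely satisfiable set of positive formulas over $\mathfrak U$ is satisfiable in $\mathfrak U$. Indiscernible means with respect to positive formulas over $\emptyset$. $\varphi(x;y)$ and $\psi(x;y)$ are mutually contradictory if $T\models\forall x,y\,\neg(\varphi(x;y)\wedge\psi(x;y))$. $\varphi$ has $\mathsf{IP}$ witnessed by such a $\psi$ if there are $A\models T$ and tuples $(a_i)_{i\in\omega}$,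 $(b_W)_{W\subseteq\omega}$ from $A$ such that $A\models\varphi(a_i;b_W)$ whenever $i\in W$ and $A\models\psi(a_i;b_W)$ whenever $i\notin W$. For mutually contradictory $\varphi,\psi$, a tuple $b$ and an indiscernible sequence $(a_i)_{i<\omega}$ in $\mathfrak U$, consider the set of $n\in\omega$ for which there are $i_0<\dots<i_n$ with $\models\varphi(a_{i_j};b)$ for even $j\le n$ and $\models\psi(a_{i_j};b)$ for odd $j\le n$. If this set is unbounded, $\operatorname{alt}(\varphi,\psi,(a_i),b)=\infty$; otherwise it is the maximum of this set (and $0$ if the set is empty). Then $\operatorname{alt}(\varphi,\psi)$ is the supremum of $\operatorname{alt}(\varphi,\psi,(a_i),b)$ over all indiscernible sequences $(a_i)_{i<\omega}$ and tuples $b$ in $\mathfrak U$. *)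

(* Defs.v *)
From mathcomp Require Import all_boot.
From mathcomp Require Import boolp classical_sets functions cardinality.

Set Implicit Arguments.
Unset Strict Implicit.
Unset Printing Implicit Defensive.

Local Open Scope classical_set_scope.
Local Open Scope card_scope.

Record language := Language {
  fsym : Type;
  farity : fsym -> nat;
  rsym : Type;
  rarity : rsym -> nat }.

Inductive term (L : language) (V : Type) : Type :=
| Var of V
| App (f : fsym L) of ('I_(farity f) -> term L V).

(* Positive formulas with free variables in V. The variable bound by [Ex] is
   [None : option V]. A formula phi(x; y) with x of length k and y of length l
   has type [formula L ('I_k + 'I_l)], and a formula with variables in V and
   parameters in M has type [formula L (V + M)]. *)
Inductive formula (L : language) (V : Type) : Type :=
| Eq of term L V & term L V
| Rel (r : rsym L) of ('I_(rarity r) -> term L V)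
| Top
| Bot
| And of formula L V & formula L V
| Or of formula L V & formula L V
| Ex of formula L (option V).

Record structure (L : language) := Structure {
  carrier :> Type;
  carrier_inhabited : inhabited carrier;
  finterp : forall f : fsym L, ('I_(farity f) -> carrier) -> carrier;
  rinterp : forall r : rsym L, ('I_(rarity r) -> carrier) -> Prop }.

Fixpoint eval (L : language) (M : structure L) (V : Type) (v : V -> M)
    (t : term L V) : M :=
  match t with
  | Var x => v x
  | App f ts => finterp (fun i => eval v (ts i))
  end.

Fixpoint sat (L : language) (M : structure L) (V : Type)
    (phi : formula L V) : (V -> M) -> Prop :=
  match phi with
  | Eq s t => fun v => eval v s = eval v t
  | Rel r ts => fun v => rinterp (fun i => eval v (ts i))
  | Top => fun=> True
  | Bot => fun=> False
  | And p q => fun v => sat p v /\ sat q v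
  | Or p q => fun v => sat p v \/ sat q v
  | Ex p => fun v => exists m : M, sat p (oapp v m)
  end.

Definition join (A B C : Type) (f : A -> C) (g : B -> C) (s : A + B) : C :=
  match s with inl a => f a | inr b => g b end.

(* The sentence forall x, (hyp x -> concl x) with x of length [hlen]. *)
Record h_inductive (L : language) := HInductive {
  hlen : nat;
  hyp : formula L 'I_hlen;
  concl : formula L 'I_hlen }.

Definition models (L : language) (M : structure L)
    (T : set (h_inductive L)) : Prop :=
  forall s, T s -> forall a : 'I_(hlen s) -> M, sat (hyp s) a -> sat (concl s) a.

Definition consistent (L : language) (T : set (h_inductive L)) : Prop :=
  exists M : structure L, models M T.

Definition homomorphism (L : language) (M N : structure L) (f : M -> N) : Prop :=
  forall (n : nat) (phi : formula L 'I_n) (a : 'I_n -> M),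
    sat phi a -> sat phi (f \o a).

Definition immersion (L : language) (M N : structure L) (f : M -> N) : Prop :=
  homomorphism f /\
  forall (n : nat) (phi : formula L 'I_n) (a : 'I_n -> M),
    sat phi (f \o a) -> sat phi a.

Definition automorphism (L : language) (M : structure L) (f : M -> M) : Prop :=
  homomorphism f /\
  exists2 g : M -> M, homomorphism g & cancel f g /\ cancel g f.

Definition pec (L : language) (T : set (h_inductive L)) (M : structure L) : Prop :=
  models M T /\
  forall (N : structure L) (f : M -> N),
    models N T -> homomorphism f -> immersion f.

Definition joint_continuation (L : language) (T : set (h_inductive L)) : Prop :=
  forall M1 M2 : structure L, models M1 T -> models M2 T ->
    exists (N : structure L) (f1 : M1 -> N) (f2 : M2 -> N),
      [/\ models N T, homomorphism f1 & homomorphism f2].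

(* The cardinal kappa-bar is represented by a type K of that cardinality. *)
Definition small (K X : Type) (A : set X) : Prop :=
  A #<= [set: K] /\ ~ ([set: K] #<= A).

(* A partial map with domain D is represented by a total function, of which
   only the values on D matter. *)
Definition partial_immersion (L : language) (M : structure L) (D : set M)
    (f : M -> M) : Prop :=
  forall (n : nat) (phi : formula L 'I_n) (a : 'I_n -> M),
    (forall i, D (a i)) -> (sat phi a <-> sat phi (f \o a)).

Definition homogeneous (K : Type) (L : language) (U : structure L) : Prop :=
  forall (D : set U) (f : U -> U), small K D -> partial_immersion D f ->
    exists2 g : U -> U, automorphism g & forall x, D x -> g x = f x.

Definition satisfiable (L : language) (M : structure L) (V : Type)
    (G : set (formula L (V + M))) : Prop :=
  exists v : V -> M, forall phi, G phi -> sat phi (join v id).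

Definition finitely_satisfiable (L : language) (M : structure L) (V : Type)
    (G : set (formula L (V + M))) : Prop :=
  forall D, finite_set D -> D `<=` G -> satisfiable D.

Definition saturated (K : Type) (L : language) (U : structure L) : Prop :=
  forall (V : Type) (G : set (formula L (V + U))),
    small K G -> finitely_satisfiable G -> satisfiable G.

(* "kappa-bar is sufficiently large" is read as: kappa-bar is greater than the
   number of formulas, i.e. than |L| + aleph_0. *)
Definition monster (K : Type) (L : language) (T : set (h_inductive L))
    (U : structure L) : Prop :=
  [/\ small K [set: formula L nat], pec T U, homogeneous K U & saturated K U].

Definition mutually_contradictory (L : language) (T : set (h_inductive L))
    (k l : nat) (phi psi : formula L ('I_k + 'I_l)) : Prop :=
  forall M : structure L, models M T ->
    forall (a : 'I_k -> M) (b : 'I_l -> M),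
      ~ (sat phi (join a b) /\ sat psi (join a b)).

Definition has_IP (L : language) (T : set (h_inductive L)) (k l : nat)
    (phi psi : formula L ('I_k + 'I_l)) : Prop :=
  exists A : structure L, models A T /\
  exists (a : nat -> 'I_k -> A) (b : set nat -> 'I_l -> A),
    forall (i : nat) (W : set nat),
      (W i -> sat phi (join (a i) (b W))) /\
      (~ W i -> sat psi (join (a i) (b W))).

Definition increasing (n : nat) (i : 'I_n -> nat) : Prop :=
  forall p q : 'I_n, p < q -> i p < i q.

(* The variable (p, r) of theta stands for the r-th entry of the p-th tuple. *)
Definition indiscernible (L : language) (M : structure L) (k : nat)
    (a : nat -> 'I_k -> M) : Prop :=
  forall (n : nat) (theta : formula L ('I_n * 'I_k)) (i j : 'I_n -> nat),
    increasing i -> increasing j ->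
    (sat theta (fun v => a (i v.1) v.2) <-> sat theta (fun v => a (j v.1) v.2)).

Inductive enat := Fin of nat | Infty.

Definition enat_le (x y : enat) : bool :=
  match x, y with
  | _, Infty => true
  | Fin m, Fin n => m <= n
  | Infty, Fin _ => false
  end.

Definition enat_bound (S : set enat) (N : nat) : bool :=
  `[< forall x, S x -> enat_le x (Fin N) >].

(* The least upper bound; in particular it is 0 for the empty set, and it is the
   maximum for a nonempty bounded set. *)
Definition enat_sup (S : set enat) : enat :=
  match pselect (exists N, enat_bound S N) with
  | left bounded => Fin (ex_minn bounded)
  | right _ => Infty
  end.

Definition alternations (L : language) (M : structure L) (k l : nat)
    (phi psi : formula L ('I_k + 'I_l)) (a : nat -> 'I_k -> M)
    (b : 'I_l -> M) : set nat :=
  [set n | exists i : 'I_n.+1 -> nat, increasing i /\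
    forall j : 'I_n.+1,
      (~~ odd j -> sat phi (join (a (i j)) b)) /\
      (odd j -> sat psi (join (a (i j)) b))].

Definition alt_seq (L : language) (M : structure L) (k l : nat)
    (phi psi : formula L ('I_k + 'I_l)) (a : nat -> 'I_k -> M)
    (b : 'I_l -> M) : enat :=
  enat_sup (Fin @` alternations phi psi a b).

Definition alt (L : language) (U : structure L) (k l : nat)
    (phi psi : formula L ('I_k + 'I_l)) : enat :=
  enat_sup [set x | exists (a : nat -> 'I_k -> U) (b : 'I_l -> U),
    indiscernible a /\ x = alt_seq phi psi a b].

(* Main.v *)
From Stdlib Require Import List.
Require Import Defs.
From mathcomp Require Import all_boot.
From mathcomp Require Import boolp classical_sets functions cardinality wochoice.
From mathcomp Require Import zify.

(** Both conditions are equivalent to a third one about [U] alone. For each cut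
    of a finite set of indices into two parts, a positive formula says that
    some [b] satisfies [phi(x_j; b)] for the [j] in one part and [psi(x_j; b)]
    for the [j] in the other. The condition is that the set of these formulas,
    in variables [x_0, x_1, ...], is finitely satisfiable in [U]
    ([shattering]).

    From alternations to shattering: along an indiscernible sequence with at
    least [2n] alternations, each of the [n] successive pairs of indices
    offers one index where [phi] holds and one where [psi] holds. Choosing one
    index in each pair realizes any prescribed cut, and since the existence of
    a suitable [b] is a positive formula, indiscernibility moves the cut to
    every [n]-tuple of the sequence ([alternation_shatters]).

    From IP to shattering: by joint continuation a model with IP and [U] map
    to a common model, and as [U] is pec, its map is an immersion. So every
    finite, hence positive existential, piece of the pattern is reflected in
    [U] ([shattered_of_IP]).

    From shattering, a saturated [U] contains a shattered sequence [a], and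
    then, [a] being a set of parameters, one [b] for each subset of the
    indices. This is IP. If moreover [a] is indiscernible, the [b] of the even
    indices gives infinite alternation.

    The heart of the matter is thus to find an indiscernible sequence that
    realizes a finitely satisfiable, shift-invariant condition
    ([indiscernible_realization]). Failure of a positive formula is not a
    positive condition, so Ramsey's theorem and compactness do not produce such
    a sequence. Instead, take by Zorn's lemma a maximal set [S] of formulas
    [theta(x_1, ..., x_n)], for all [n], whose instances at all increasing
    tuples of indices are jointly finitely satisfiable. Any realization of the
    instances of [S] is indiscernible, because a formula that holds at one
    increasing tuple must belong to [S] ([maximal_templates_complete]). To see
    it for a given [n], let [W] be a well-order so long that every colouring of
    its [n]-tuples by formulas has an infinite homogeneous subset (a form of
    the Erdos-Rado theorem, [partition_property_exists]), and let [q] be a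
    maximal finitely satisfiable set of formulas in variables indexed by [W]
    that contains the instances of [S]. If for each increasing tuple [w] the
    set [q] contained [theta_w(x_w)] with [theta_w] outside [S], an infinite
    subset homogeneous for [w |-> theta_w] would show that one of these
    formulas can be added to [S]. So the formulas that [q] contains at some [w]
    all belong to [S]. For [theta] outside [S], [q] is then inconsistent with
    [theta(x_w)], hence so is a finite part of [q]; quantifying away the
    variables outside [w] turns this part into a formula of [S] that contradicts
    [theta], and it holds at all increasing tuples of the realization. All this
    takes place in finitely satisfiable sets of formulas, so that the length of
    [W] is not limited by the saturation of [U]. *)

Set Implicit Arguments.
Unset Strict Implicit.
Unset Printing Implicit Defensive.

Local Open Scope classical_set_scope.
Local Open Scope card_scope.

(** * Well-orders with homogeneous sequences *)

Definition strict_well_order (A : Type) (lt : rel A) : Prop :=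
  [/\ irreflexive lt, transitive lt,
      forall x y, [\/ x = y, lt x y | lt y x] & well_founded lt].

Lemma well_founded_min (A : Type) (lt : rel A) (P : set A) (x : A) :
  well_founded lt -> P x -> exists2 y, P y & forall z, P z -> ~ lt z y.
Proof.
move=> wf; elim/(well_founded_ind wf): x => x IH Px.
have [[z Pz zx]|no] := pselect (exists2 z, P z & lt z x); first exact: IH zx Pz.
by exists x => // z Pz zx; apply: no; exists z.
Qed.

(** The well-ordering principle comes with a non-strict order, given only by
    the existence of least elements. Transitivity of its strict part is read
    off the least element of a set of three. *)
Lemma strict_well_order_of_eqType (A : eqType) :
  exists lt : rel A, strict_well_order lt.
Proof.
have [R wo] := well_ordering_principle A.
have woT : wo_chain R predT by move=> C _; apply: wo.
have Rxx := wo_chain_reflexive woT.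
have Ranti := wo_chain_antisymmetric woT.
have Rtot := wo_chainW woT.
pose lt : rel A := fun x y => (x != y) && R x y.
have least (C : {pred A}) x : x \in C ->
    exists2 z, z \in C & forall y, y \in C -> R z y.
  by move=> Cx; have [z [[Cz lbz] _]] := wo C (ex_intro _ x Cx); exists z.
exists lt; split.
- by move=> x; rewrite /lt eqxx.
- move=> y x z /andP[xy Rxy] /andP[yz Ryz].
  have [w] := least (mem [:: x; y; z]) x (mem_head _ _).
  rewrite !inE => wC lb.
  have Rw v : v \in [:: x; y; z] -> R w v by move/lb.
  case/or3P: wC => /eqP wE; subst w.
  + rewrite /lt Rw ?inE ?eqxx ?orbT // andbT.
    apply: contraNneq xy => xz; subst z.
    by apply/eqP; apply: Ranti; rewrite // Rxy Ryz.
  + case/eqP: xy; apply: Ranti => //.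
    by rewrite Rxy Rw // inE eqxx.
  + case/eqP: yz; apply: Ranti => //.
    by rewrite Ryz Rw // !inE eqxx ?orbT.
- move=> x y; have [->|xy] := eqVneq x y; first by constructor 1.
  case/orP: (Rtot x y isT isT) => Rxy; [constructor 2|constructor 3].
  + by rewrite /lt xy.
  + by rewrite /lt eq_sym xy.
- move=> x; apply: contrapT => nacc.
  have [|z] := least (fun y => `[< ~ Acc lt y >]) x; first exact/asboolP.
  move=> /asboolP nz lb; apply: nz; constructor => y /andP[yz Ryz].
  apply: contrapT => ny; case/eqP: yz; apply: Ranti => //.
  by rewrite Ryz lb //; apply/asboolP.
Qed.

Lemma strict_well_order_exists (A : Type) :
  exists lt : rel A, strict_well_order lt.
Proof. exact: (strict_well_order_of_eqType {classic A}). Qed.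

(** Since [E] is total, it can be mapped over lists inside [step]; the price is
    the hypothesis that later values do not influence the result. *)
Lemma well_founded_recursion (A B : Type) (lt : rel A)
    (step : A -> (A -> B) -> B) (b0 : B) :
  well_founded lt ->
  (forall a f g, (forall a', lt a' a -> f a' = g a') -> step a f = step a g) ->
  exists E : A -> B, forall a, E a = step a E.
Proof.
move=> wf stepP.
pose ext a (rec : forall a', lt a' a -> B) a' :=
  if pselect (lt a' a) is left H then rec a' H else b0.
exists (Fix wf (fun=> B) (fun a rec => step a (ext a rec))) => a.
rewrite Fix_eq; last first.
  by move=> a' f g fg; apply: stepP => a'' _; rewrite /ext; case: pselect => // H.
by apply: stepP => a' lta; rewrite /ext; case: pselect.
Qed.

Lemma eq_map_all (A B : Type) (p : pred A) (f g : A -> B) (s : seq A) :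
  all p s -> (forall a, p a -> f a = g a) -> map f s = map g s.
Proof. by move=> + fg; elim: s => //= a s IH /andP[/fg-> /IH->]. Qed.

Lemma cantor (X : Type) (f : set X -> X) : ~ injective f.
Proof.
move=> finj; pose D : set X := [set x | exists2 S, f S = x & ~ S x].
have nD : ~ D (f D).
  by case=> S /finj -> nD; apply: (nD); exists D.
by apply: (nD); exists D.
Qed.

(** In arrow notation, [A -> (omega)^n_F]. A colouring is a function on all
    lists because increasing lists would need a type of their own. *)
Definition partition_property (n : nat) (F A : Type) (lt : rel A) : Prop :=
  forall c : seq A -> F, exists (h : nat -> A) (f : F),
    (forall i j, i < j -> lt (h i) (h j)) /\
    (forall s, size s = n -> pairwise ltn s -> c (map h s) = f).

(** The stepping-up argument of Erdos and Rado. Each [x] in [B] guides a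
    recursion over [A], in which [E x a] is the least element above all earlier
    values that has, over tuples of earlier values, the same colours as [x].
    If this recursion never reaches [x], then it stays below [x] and gives the
    sequence sought, the colours being those of [x]. If it reaches [x] at stage
    [a x], then [x] is determined by [a x] and by the colours of [x] over the
    earlier values, because these data determine the recursion. So, if [x] is
    always reached, [B] is no larger than a set computed from [A] and [F]. *)
Lemma end_homogeneous (n : nat) (F A B : Type) (ltA : rel A) (ltB : rel B)
    (c : seq B -> F) :
  strict_well_order ltA -> strict_well_order ltB ->
  ~ (exists code : B -> A * (seq A -> option F), injective code) ->
  exists (e : A -> B) (d : seq A -> F),
    (forall a a', ltA a a' -> ltB (e a) (e a')) /\
    (forall s a, size s = n -> pairwise ltA s -> all (ltA^~ a) s ->
      c (rcons (map e s) (e a)) = d s).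
Proof.
move=> [_ trA totA wfA] [irrB trB totB wfB] nocode.
(* [P x a f y]: [y] may be the value at [a] of the recursion guided by [x]. *)
pose P x a (f : A -> B) y :=
  (forall a', ltA a' a -> ltB (f a') y) /\
  (forall s, size s = n -> pairwise ltA s -> all (ltA^~ a) s ->
    c (rcons (map f s) y) = c (rcons (map f s) x)).
pose least (Q : set B) y := Q y /\ forall z, Q z -> ~ ltB z y.
have least_uniq Q y z : least Q y -> least Q z -> y = z.
  by move=> [Qy ly] [Qz lz]; case: (totB y z) => // [/(lz _ Qy)|/(ly _ Qz)].
pose step x a f := @xget {classic B} x (least (P x a f)).
have PE x a f g : (forall a', ltA a' a -> f a' = g a') -> P x a f = P x a g.
  move=> fg; apply/funext => y; apply/propext.
  have mapE s : all (ltA^~ a) s -> map f s = map g s.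
    by move=> /eq_map_all; apply.
  split=> -[Pl Pc]; split.
  - by move=> a' lta; rewrite -fg //; apply: Pl.
  - by move=> s ss ps als; rewrite -mapE //; apply: Pc.
  - by move=> a' lta; rewrite fg //; apply: Pl.
  - by move=> s ss ps als; rewrite mapE //; apply: Pc.
have /choice[E EE] x : exists E, forall a, E a = step x a E.
  by apply: (well_founded_recursion x wfA) => a f g /PE fg; rewrite /step fg.
have leastE x a y : P x a (E x) y -> least (P x a (E x)) (E x a).
  move=> Py; have [z Pz lz] := well_founded_min wfB Py.
  rewrite EE.
  exact: (@xgetI {classic B} x (least (P x a (E x))) z (conj Pz lz)).
(* Some [x] is never reached: its recursion is the end-homogeneous copy. *)
have [[x Ex]|stop] := pselect (exists x, forall a, E x a <> x).
  have below a : ltB (E x a) x /\ least (P x a (E x)) (E x a).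
    elim/(well_founded_ind wfA): a => a IH.
    have Px : P x a (E x) x by split=> // a' /IH[].
    have lE := leastE _ _ _ Px; split=> //.
    by case: (totB (E x a) x) => [/Ex|//|xE] //; case: (lE.2 _ Px xE).
  exists (E x), (fun s => c (rcons (map (E x) s) x)); split.
    by move=> a a' lta; have [_ [[+ _] _]] := below a'; apply.
  by move=> s a ss ps als; have [_ [[_ +] _]] := below a; apply.
(* Every [x] is reached: let [a x] be the first stage at which it is. *)
have {}stop x : exists a, E x a = x /\ forall a', ltA a' a -> E x a' <> x.
  have [a Ea] : exists a, E x a = x.
    by apply: contrapT => no; apply: stop; exists x => a Ea; apply: no; exists a.
  have [b Eb lb] := @well_founded_min _ _ (fun a => E x a = x) _ wfA Ea.
  by exists b; split=> // a' lta /lb; apply.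
have [a aP] := choice stop.
have belowE x a' : ltA a' (a x) -> ltB (E x a') x.
  elim/(well_founded_ind wfA): a' => a' IH lta.
  have Px : P x a' (E x) x.
    by split=> // a'' lt'; apply: IH => //; apply: trA lta.
  have lE := leastE _ _ _ Px.
  case: (totB (E x a') x) => [|//|xE]; last by case: (lE.2 _ Px xE).
  by move/((aP x).2 _ lta).
have Pself x a' : (a' = a x \/ ltA a' (a x)) -> P x a' (E x) x.
  move=> aa; split=> // a'' lta; apply: belowE.
  by case: aa => [<-//|]; apply: trA.
case: nocode; exists (fun x => (a x, fun s =>
  if `[< size s = n >] && pairwise ltA s && all (ltA^~ (a x)) s
  then Some (c (rcons (map (E x) s) x)) else None)).
move=> x x' [axx' cE].
(* Equal codes impose the same requirement at each stage up to [a x]. *)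
have same b : (b = a x \/ ltA b (a x)) -> E x b = E x' b.
  elim/(well_founded_ind wfA): b => b IH bx.
  have EQ b' : ltA b' b -> E x b' = E x' b'.
    move=> b'b; apply: IH => //; right.
    by case: bx => [<-//|]; apply: trA.
  apply: (@least_uniq (P x b (E x))).
    by apply: (leastE _ _ x); apply: Pself.
  have -> : P x b (E x) = P x' b (E x').
    rewrite (PE _ _ _ _ EQ); apply/funext => y; apply/propext.
    have colE s : size s = n -> pairwise ltA s -> all (ltA^~ b) s ->
        c (rcons (map (E x') s) x) = c (rcons (map (E x') s) x').
      move=> ss ps als; have alx : all (ltA^~ (a x)) s.
        case: bx => [<-//|bx]; apply: sub_all als => z zb.
        exact: trA zb bx.
      have := f_equal (fun g => g s) cE.
      rewrite -axx' alx ps (asboolT ss) /= => -[].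
      by rewrite (eq_map_all als EQ).
    by split=> -[Pl Pc]; split=> // s ss ps als; rewrite Pc // colE.
  by apply: (leastE _ _ x'); apply: Pself; rewrite -axx'.
by rewrite -(aP x).1 same ?axx'; [rewrite (aP x').1|left].
Qed.

(** By induction on [n]: if [A] works for [n], then any well-order on a set
    larger than the set of codes of [end_homogeneous] works for [n + 1], since
    on an end-homogeneous copy of [A] the colour depends on the first [n]
    entries only. *)
Lemma partition_property_exists (n : nat) (F : Type) :
  exists (A : Type) (lt : rel A),
    strict_well_order lt /\ partition_property n F lt.
Proof.
elim: n => [|n [A [ltA [woA IH]]]].
  exists nat, ltn; split.
    split; [exact: ltnn|exact: ltn_trans| |].
      by move=> x y; case: (ltngtP x y) => H; [constructor 2|constructor 3|constructor 1].
    by move=> x; elim/ltn_ind: x => x IH; constructor => y /IH.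
  by move=> c; exists id, (c [::]); split=> // s /size0nil->.
have [ltB woB] := strict_well_order_exists (set (A * (seq A -> option F))).
exists _, ltB; split=> // c.
have [|e [d [emon ec]]] := @end_homogeneous n F A _ ltA ltB c woA woB.
  by move=> [code] /cantor.
have [h [f [hmon hc]]] := IH d.
exists (e \o h), f; split=> [i j ij|s]; first exact/emon/hmon.
case/lastP: s => // s m; rewrite size_rcons => -[ss].
rewrite pairwise_rcons => /andP[sm ps].
rewrite map_rcons map_comp ec ?size_map //.
- exact: hc.
- by rewrite pairwise_map; apply: sub_pairwise ps => i j; apply: hmon.
- by rewrite all_map; apply: sub_all sm => i; apply: hmon.
Qed.

(** * Renaming and projection of positive formulas *)

Fixpoint rename_term (L : language) (V W : Type) (f : V -> W) (t : term L V) :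
    term L W :=
  match t with
  | Var x => Var L (f x)
  | App g ts => App (fun i => rename_term f (ts i))
  end.

Fixpoint rename (L : language) (V : Type) (phi : formula L V) :
    forall W : Type, (V -> W) -> formula L W :=
  match phi with
  | Eq s t => fun W f => Eq (rename_term f s) (rename_term f t)
  | Rel r ts => fun W f => Rel (fun i => rename_term f (ts i))
  | Top => fun W _ => Top L W
  | Bot => fun W _ => Bot L W
  | And p q => fun W f => And (rename p f) (rename q f)
  | Or p q => fun W f => Or (rename p f) (rename q f)
  | Ex p => fun W f => Ex (rename p (option_map f))
  end.

Lemma eval_rename (L : language) (M : structure L) (V W : Type) (f : V -> W)
    (t : term L V) (v : W -> M) : eval v (rename_term f t) = eval (v \o f) t.
Proof.
by elim: t => //= g ts IH; congr finterp; apply/funext => i; rewrite IH.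
Qed.

Lemma sat_rename (L : language) (M : structure L) (V W : Type) (f : V -> W)
    (phi : formula L V) (v : W -> M) : sat (rename phi f) v = sat phi (v \o f).
Proof.
elim: phi W f v => {V} /= [V s t|V r ts|//|//|V p IHp q IHq|V p IHp q IHq|V p IHp] W f v.
- by rewrite !eval_rename.
- by congr rinterp; apply/funext => i; rewrite eval_rename.
- by rewrite IHp IHq.
- by rewrite IHp IHq.
- apply: eq_exists => m; rewrite IHp; congr sat.
  by apply/funext => -[].
Qed.

Lemma rename_rename (L : language) (V W X : Type) (f : V -> W) (g : W -> X)
    (phi : formula L V) : rename (rename phi f) g = rename phi (g \o f).
Proof.
have rt Y Z S (h : Y -> Z) (h' : Z -> S) (t : term L Y) :
    rename_term h' (rename_term h t) = rename_term (h' \o h) t.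
  by elim: t => //= r ts IH; congr App; apply/funext.
elim: phi W X f g => {V} /=
  [V s t|V r ts|//|//|V p IHp q IHq|V p IHp q IHq|V p IHp] W X f g.
- by rewrite !rt.
- by congr Rel; apply/funext => i.
- by rewrite IHp IHq.
- by rewrite IHp IHq.
- rewrite IHp; congr (Ex (rename p _)).
  by apply/funext => -[].
Qed.

Lemma eval_support (L : language) (V : Type) (t : term L V) :
  exists s : seq {classic V}, forall (M : structure L) (v w : V -> M),
    {in s, v =1 w} -> eval v t = eval w t.
Proof.
elim: t => [x|f ts /choice[s sP]].
  by exists [:: x] => M v w; apply; apply: mem_head.
exists (flatten [seq s i | i : 'I_(farity f)]) => M v w vw /=.
congr finterp; apply/funext => i; apply: sP => x xs; apply: vw.
by apply/flattenP; exists (s i) => //; apply: codom_f.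
Qed.

(** The support is a list over a type with classical equality, and it serves
    all structures at once; this uniformity makes [projection_exists] give
    one formula for all structures. *)
Lemma sat_support (L : language) (V : Type) (phi : formula L V) :
  exists s : seq {classic V}, forall (M : structure L) (v w : V -> M),
    {in s, v =1 w} -> sat phi v -> sat phi w.
Proof.
elim: phi => {V} [V a b|V r ts|V|V|V p [s sP] q [t tP]|V p [s sP] q [t tP]|V p [s sP]].
- have [s sP] := eval_support a; have [t tP] := eval_support b.
  exists (s ++ t) => M v w vw /=.
  rewrite (sP _ v w) ?(tP _ v w) // => x xs; apply: vw;
  by rewrite mem_cat xs ?orbT.
- have /choice[s sP] := fun i => eval_support (ts i).
  exists (flatten [seq s i | i : 'I_(rarity r)]) => M v w vw /=.
  suff -> : (fun i => eval v (ts i)) = (fun i => eval w (ts i)) by [].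
  apply/funext => i; apply: sP => x xs; apply: vw.
  by apply/flattenP; exists (s i) => //; apply: codom_f.
- by exists [::].
- by exists [::].
- exists (s ++ t) => M v w vw /= [pv qv].
  split; [apply: sP pv|apply: tP qv] => x xs; apply: vw;
  by rewrite mem_cat xs ?orbT.
- exists (s ++ t) => M v w vw /= [pv|qv].
    by left; apply: sP pv => x xs; apply: vw; rewrite mem_cat xs.
  by right; apply: tP qv => x xs; apply: vw; rewrite mem_cat xs orbT.
- exists (pmap id (s : seq (option {classic V}))) => M v w vw /= [m pm]; exists m.
  apply: sP pm => -[x|] //= xs; apply: vw.
  elim: s xs => //= -[y|] t IH; rewrite inE => /orP[/eqP // [->]|/IH xt].
  - exact: mem_head.
  - by rewrite inE xt orbT.
  - by [].
Qed.

(** A block of existential quantifiers, one variable at a time: the first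
    variable of the block becomes the bound variable [None]. *)
Fixpoint exists_block (L : language) (m : nat) :
    forall V : Type, formula L (V + 'I_m) -> formula L V :=
  match m with
  | 0 => fun V phi => rename phi (fun z =>
      match z with inl x => x | inr i => False_rect _ (notF (ltn_ord i)) end)
  | m'.+1 => fun V phi => Ex (exists_block (rename phi (fun z =>
      match z with
      | inl x => inl (Some x)
      | inr i => if unlift ord0 i is Some j then inr j else inl None
      end)))
  end.

Lemma sat_exists_block (L : language) (M : structure L) (m : nat) (V : Type)
    (phi : formula L (V + 'I_m)) (v : V -> M) :
  sat (exists_block phi) v <-> exists b : 'I_m -> M, sat phi (join v b).
Proof.
elim: m V phi v => [|m IH] V phi v /=.
  rewrite sat_rename; split => [pv|[b pb]].
    exists (fun i : 'I_0 => False_rect _ (notF (ltn_ord i))).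
    move: pv; congr sat; apply/funext => -[//|i].
    by case: (notF (ltn_ord i)).
  move: pb; congr sat; apply/funext => -[//|i].
  by case: (notF (ltn_ord i)).
split=> [[x /IH[b]]|[b pb]].
  rewrite sat_rename => pb.
  exists (fun i => if unlift ord0 i is Some j then b j else x).
  move: pb; congr sat; apply/funext => -[//|i] /=.
  by case: (unlift _ i).
exists (b ord0); apply/IH; exists (b \o lift ord0); rewrite sat_rename.
move: pb; congr sat; apply/funext => -[//|i] /=.
by case: (unliftP ord0 i) => [j|] ->.
Qed.

(** The image of a positively definable set under the restriction of
    assignments along [f] is positively definable: only the finitely many
    variables in the support of [phi] have to be considered, and those outside
    the range of [f] can be quantified away. *)
Lemma projection_exists (L : language) (X V : Type) (f : X -> V)
    (phi : formula L V) : injective f ->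
  exists psi : formula L X, forall (M : structure L) (x : X -> M),
    sat psi x <-> exists2 u : V -> M, u \o f = x & sat phi u.
Proof.
move=> finj; have [s sP] := sat_support phi.
(* [inord] needs a nonempty range, hence one index more than the support. *)
pose g (y : V) : X + 'I_(size s).+1 :=
  if pselect (exists x, f x = y) is left H then inl (projT1 (cid H))
  else inr (inord (index (y : {classic V}) s)).
have gf x : g (f x) = inl x.
  rewrite /g; case: pselect => [H|no]; last by case: no; exists x.
  by congr inl; apply: finj; case: (cid H).
exists (exists_block (rename phi g)) => M x.
rewrite sat_exists_block; split=> [[b]|[u <- pu]].
  rewrite sat_rename => pb; exists (join x b \o g) => //.
  by apply/funext => y /=; rewrite gf.
have [m0] := carrier_inhabited M.
exists (fun i => nth m0 (map u s) i); rewrite sat_rename.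
apply: sP pu => y ys /=; rewrite /g; case: pselect => [H|_] /=.
  by case: (cid H) => z /= ->.
by rewrite inordK ?ltnS ?index_size // (nth_map y) ?index_mem // nth_index.
Qed.

Definition conjunction (L : language) (V : Type) (s : seq (formula L V)) :
  formula L V := foldr (@And L V) (Top L V) s.

Lemma sat_conjunction (L : language) (M : structure L) (V : Type)
    (s : seq (formula L V)) (v : V -> M) :
  sat (conjunction s) v <-> Forall (fun phi => sat phi v) s.
Proof.
elim: s => [|phi s IH] /=; first by split.
by rewrite IH; split=> [[]|/Forall_cons_iff]; first by constructor.
Qed.

(** * Maximal finitely satisfiable sets and indiscernibility *)

Definition finsat (L : language) (M : structure L) (V : Type)
    (G : set (formula L V)) : Prop :=
  forall s, Forall G s -> exists v : V -> M, Forall (fun phi => sat phi v) s.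

(** Zorn's lemma for sets [A] that generate a finitely satisfiable set [G A].
    As each formula of [G A] needs only one element of [A], finitely many
    formulas over the union of a chain already appear over one member. *)
Lemma maximal_finsat (L : language) (M : structure L) (X V : Type)
    (G : set X -> set (formula L V)) (A0 : set X) :
  (forall A phi, G A phi -> exists2 x, A x & forall B : set X, B x -> G B phi) ->
  finsat M (G A0) ->
  exists A, [/\ A0 `<=` A, finsat M (G A) &
    forall x, finsat M (G (A `|` [set x])) -> A x].
Proof.
move=> Gx fin0.
have Gmono (A B : set X) : A `<=` B -> G A `<=` G B.
  by move=> AB phi /Gx[x /AB Bx]; apply.
have [F FP totF|A [PA maxA]] :=
    @Zorn_bigcup X (fun B => finsat M (G (A0 `|` B))).
  move=> s sF.
  have [B FB sB] : exists2 B, B = set0 \/ F B & Forall (G (A0 `|` B)) s.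
    elim: s sF => [|phi s IH] sF; first by exists set0; [left|].
    move/Forall_cons_iff: sF => [/Gx[x xF xG] /IH[B FB sB]] {IH}.
    have [C FC Cx] : exists2 C, C = set0 \/ F C & (A0 `|` C) x.
      case: xF => [A0x|[C FC Cx]]; first by exists set0; left.
      by exists C; right.
    have [BC|CB] : B `<=` C \/ C `<=` B.
      case: FB FC => [->|FB] [->|FC]; try by [left; apply: sub0set|right; apply: sub0set].
      exact: totF.
    - exists C => //; constructor; first exact: xG.
      by apply: Forall_impl sB; apply: Gmono; apply: setUS.
    - exists B => //; constructor => //; apply: xG.
      by move: Cx; apply: setUS.
  case: FB sB => [->|FB]; last exact: FP.
  by rewrite setU0; apply: fin0.
exists (A0 `|` A); split=> // x; rewrite -setUA => finx.
apply: contrapT => nx; apply: maxA finx.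
split=> [|/(_ x)]; first exact: subsetUl.
by move=> Ax; apply: nx; right; apply: Ax; right.
Qed.

(** A maximal finitely satisfiable set decides every formula, where deciding
    against [phi] means to contain a finite part that contradicts [phi]. *)
Lemma maximal_refutes (L : language) (M : structure L) (V : Type)
    (q : set (formula L V)) (phi : formula L V) :
  (forall psi, finsat M (q `|` [set psi]) -> q psi) -> ~ q phi ->
  exists2 s, Forall q s &
    forall v : V -> M, Forall (fun psi => sat psi v) s -> ~ sat phi v.
Proof.
move=> qmax nq; apply: contrapT => no; apply: nq; apply: qmax => s sq.
have [s' s'q s's] : exists2 s', Forall q s' & forall v : V -> M,
    Forall (fun psi => sat psi v) s' -> sat phi v ->
    Forall (fun psi => sat psi v) s.
  elim: s sq => [|psi s IH]; first by exists [::].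
  move=> /Forall_cons_iff[psiq /IH[s' s'q s's]].
  case: psiq => [psiq|->].
    exists (psi :: s') => [|v /Forall_cons_iff[pv s'v] phiv]; first by constructor.
    by constructor=> //; apply: s's.
  by exists s' => // v s'v phiv; constructor=> //; apply: s's.
apply: contrapT => nov; apply: no; exists s' => // v s'v phiv.
by apply: nov; exists v; apply: s's.
Qed.

(** Templates carry no indices, so that one set of templates generates a
    shift-invariant set of instances along every linear order, and Zorn's lemma
    applies to arbitrary sets of templates. *)
Definition template (L : language) (k : nat) : Type :=
  {n : nat & formula L ('I_n * 'I_k)}.

Definition at_places (I J : Type) (k : nat) (g : J -> I) (v : J * 'I_k) :
  I * 'I_k := (g v.1, v.2).

Definition instances (L : language) (k : nat) (I : Type) (lt : rel I)
    (S : set (template L k)) : set (formula L (I * 'I_k)) :=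
  [set phi | exists2 t, S t & exists2 g : 'I_(tag t) -> I,
     (forall p q : 'I_(tag t), p < q -> lt (g p) (g q)) &
     phi = rename (tagged t) (at_places g)].

Lemma instances_witness (L : language) (k : nat) (I : Type) (lt : rel I)
    (S : set (template L k)) (phi : formula L (I * 'I_k)) :
  instances lt S phi ->
  exists2 t, S t & forall S' : set (template L k), S' t -> instances lt S' phi.
Proof. by move=> [t St gP]; exists t => // S' S't; exists t. Qed.

Lemma count_strict (A : eqType) (p q : pred A) (s : seq A) (x : A) :
  (forall y, p y -> q y) -> x \in s -> q x -> ~~ p x -> count p s < count q s.
Proof.
move=> pq + qx npx; elim: s => //= y s IH; rewrite inE => /orP[/eqP<-|xs].
  by rewrite qx (negbTE npx) add0n add1n ltnS; apply: sub_count.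
have := IH xs; rewrite -ltnS => lt; rewrite -addnS.
by apply: leq_add => //; case py: (p y) => //; rewrite pq.
Qed.

(** Finitely many instances along [W] mention finitely many indices, and these
    are embedded in [nat] by counting predecessors among them. *)
Lemma instances_finsat_order (L : language) (M : structure L) (k : nat)
    (S : set (template L k)) (W : Type) (lt : rel W) :
  irreflexive lt -> transitive lt ->
  finsat M (instances ltn S) -> finsat M (instances lt S).
Proof.
move=> irr tr fin s sS.
have [W0 W0P] : exists W0 : seq {classic W}, forall r : W -> nat,
    (forall x y, x \in W0 -> lt x y -> r x < r y) ->
    exists2 s', Forall (instances ltn S) s' & forall v : nat * 'I_k -> M,
      Forall (fun phi => sat phi v) s' ->
      Forall (fun phi => sat phi (v \o at_places r)) s.
  elim: s sS => [|phi s IH]; first by exists [::] => r _; exists [::].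
  move=> /Forall_cons_iff[[t St [g gmon ->]] /IH[W0 W0P]] {IH}.
  exists (codom (g : _ -> {classic W}) ++ W0) => r rmon.
  have [|s' s'S s's] := W0P r.
    by move=> x y xW0; apply: rmon; rewrite mem_cat xW0 orbT.
  exists (rename (tagged t) (at_places (r \o g)) :: s').
    constructor=> //; exists t => //; exists (r \o g) => // p q pq.
    by apply: rmon (gmon _ _ pq); rewrite mem_cat codom_f.
  move=> v /Forall_cons_iff[pv s'v]; constructor; last exact: s's.
  by move: pv; rewrite !sat_rename.
have [|s' s'S s's] := W0P (fun w => count (lt^~ w) W0).
  move=> x y xW0 xy; apply: (@count_strict {classic W} _ _ _ x) => //.
    by move=> z zx; apply: tr xy.
  by rewrite irr.
have [v s'v] := fin _ s'S.
by exists (v \o at_places (fun w => count (lt^~ w) W0)); apply: s's.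
Qed.

(** A maximal set of templates contains all that is true somewhere in a
    realization. This is the step in which a long well-order is needed: its
    homogeneous sequences show that the formulas that a completion [q] along
    [W] has at some increasing tuple [w] are all in [S], so that the type of
    [w] in [q] is described by [S]. *)
Lemma maximal_templates_complete (L : language) (M : structure L) (k : nat)
    (S : set (template L k)) (v : nat * 'I_k -> M) (n : nat)
    (theta : formula L ('I_n * 'I_k)) (g : 'I_n -> nat) :
  finsat M (instances ltn S) ->
  (forall t, finsat M (instances ltn (S `|` [set t])) -> S t) ->
  (forall phi, instances ltn S phi -> sat phi v) ->
  (forall p q : 'I_n, p < q -> g p < g q) ->
  sat theta (v \o at_places g) -> S (existT _ n theta).
Proof.
move=> Sfin Smax vS gmon thetav; apply: contrapT => nS.
have [W [lt [[irr tr tot _] part]]] :=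
  partition_property_exists n (formula L ('I_n * 'I_k)).
(* The first term of some homogeneous sequence serves as a default in [W]. *)
have [h0 _] := part (fun=> theta).
pose tup (w : seq W) (i : 'I_n) := nth (h0 0) w i.
have [q [Sq qfin qmax]] := @maximal_finsat L M _ _ id _
  (fun A phi Aphi => ex_intro2 _ _ phi Aphi (fun B Bphi => Bphi))
  (instances_finsat_order irr tr Sfin).
pose bad w eta := q (rename eta (at_places (tup w))) /\ ~ S (existT _ n eta).
have [allbad|[w [sw pw good]]] : (exists c : seq W -> formula L ('I_n * 'I_k),
      forall w, size w = n -> pairwise lt w -> bad w (c w)) \/
    exists w, [/\ size w = n, pairwise lt w &
      forall eta, q (rename eta (at_places (tup w))) -> S (existT _ n eta)].
  have [|no] := pselect (exists w, [/\ size w = n, pairwise lt w &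
      forall eta, q (rename eta (at_places (tup w))) -> S (existT _ n eta)]).
    by right.
  left; have /choice[c cP] : forall w, exists eta,
      size w = n -> pairwise lt w -> bad w eta; last by exists c.
  move=> w; have [[sw pw]|nw] := pselect (size w = n /\ pairwise lt w).
    apply: contrapT => nobad; apply: no; exists w; split=> // eta qeta.
    by apply: contrapT => nSeta; apply: nobad; exists eta.
  by exists theta => sw pw; case: nw.
- have [c cbad] := allbad; have [h [f [hmon hc]]] := part c.
  have hbad (i : 'I_n -> nat) : (forall p q : 'I_n, p < q -> i p < i q) ->
      bad (map h (map i (enum 'I_n))) f.
    move=> imon; set s := map i _.
    have ps : pairwise ltn s.
      rewrite pairwise_map; have := pairwise_map (@nat_of_ord n) ltn (enum 'I_n).
      rewrite val_enum_ord; have -> : pairwise ltn (iota 0 n).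
        by rewrite -sorted_pairwise ?iota_ltn_sorted //; apply: ltn_trans.
      move=> /esym; apply: sub_pairwise => p r; exact: imon.
    have ss : size s = n by rewrite size_map size_enum_ord.
    rewrite -(hc s) //; apply: cbad; first by rewrite size_map.
    by rewrite pairwise_map; apply: sub_pairwise ps => p r; apply: hmon.
  have [_ nf] := hbad (@nat_of_ord n) (fun _ _ => id).
  apply: nf; apply: Smax => s sS.
  (* The sequence of variables along [h] realizes [S] together with [f]. *)
  have sq : Forall q (map (fun phi => rename phi (at_places h)) s).
    apply/Forall_map; apply: Forall_impl sS => _ [t St [i imon ->]].
    rewrite rename_rename.
    case: St i imon => [St|->] i imon /=.
      apply: Sq; exists t => //; exists (h \o i) => // p r pr; exact/hmon/imon.
    have [+ _] := hbad i imon; congr q; congr rename.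
    apply/funext => -[p r]; rewrite /at_places /tup /=; congr pair.
    by rewrite -map_comp (nth_map p) ?size_enum_ord // nth_ord_enum.
  have [u su] := qfin _ sq.
  exists (u \o at_places h); move/Forall_map: su; apply: Forall_impl => phi.
  by rewrite sat_rename.
- (* The type of [w] in [q] lies in [S], so [q] refutes [theta] at [w]. *)
  pose f := @at_places W _ k (tup w).
  have finj : injective f.
    have tinj : injective (tup w).
      have mon (p r : 'I_n) : p < r -> lt (tup w p) (tup w r).
        by move=> pr; move/(pairwiseP (h0 0)): pw; apply; rewrite // inE sw.
      move=> p r; case: (ltngtP p r) => [/mon|/mon|/val_inj //] + pr;
      by rewrite pr irr.
    by move=> [p i] [r j] [/tinj -> ->].
  have nq : ~ q (rename theta f) by move=> /good.
  have [s sq sref] := maximal_refutes qmax nq.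
  (* [chi] is the part of the refutation that concerns only [w]; it belongs to
     [S] since [q] is closed under consequences. *)
  have [chi chiP] := projection_exists (conjunction s) finj.
  have qchi : q (rename chi f).
    apply: contrapT => /(maximal_refutes qmax)[s' s'q s'ref].
    have [u] := qfin (s ++ s') (proj2 (Forall_app _ _ _) (conj sq s'q)).
    move=> /Forall_app[su s'u]; apply: (s'ref u) => //.
    by rewrite sat_rename; apply/chiP; exists u => //; apply/sat_conjunction.
  have : sat (rename chi (at_places g)) v.
    by apply: vS; exists (existT _ n chi); [exact: good|exists g].
  rewrite sat_rename => /chiP[u uf /sat_conjunction su].
  by apply: (sref u) => //; rewrite sat_rename uf.
Qed.

(** * Realizations in a saturated structure *)

Lemma small_card_le (K X Y : Type) (A : set X) (B : set Y) :
  A #<= B -> small K B -> small K A.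
Proof.
move=> AB [BK KB]; split; first exact: card_le_trans BK.
by move=> KA; apply: KB; apply: card_le_trans KA AB.
Qed.

(** The equations [x_n = x_n] are infinitely many formulas, so smallness of the
    set of formulas makes countable sets of formulas with parameters small. *)
Lemma small_nat (K : Type) (L : language) :
  small K [set: formula L nat] -> small K [set: nat].
Proof.
apply: small_card_le.
pose f (n : nat) := Eq (Var L n) (Var L n).
have finj : {in [set: nat] &, injective f} by move=> m n _ _ [].
by rewrite -(card_le_eql (inj_card_eq finj)); apply: card_leT.
Qed.

Lemma saturated_satisfiable (K : Type) (L : language) (U : structure L)
    (V : Type) (G : set (formula L (V + U))) :
  saturated K U -> small K G ->
  (forall s, Forall G s ->
     exists v : V -> U, Forall (fun phi => sat phi (join v id)) s) ->
  satisfiable G.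
Proof.
move=> Usat Gsmall fin; apply: Usat => // D Dfin DG.
have [s Ds] := (@finite_seqP {classic formula L (V + U)} D).1 Dfin.
have memF (P : set (formula L (V + U))) : {in s, forall phi, P phi} <-> Forall P s.
  elim: (s) => [|phi t IH]; first by split=> // _; constructor.
  rewrite Forall_cons_iff -IH; split=> [Pt|[Pphi Pt] psi].
    by split=> [|psi psit]; apply: Pt; rewrite inE ?eqxx // psit orbT.
  by rewrite inE => /orP[/eqP->|/Pt].
have [|v /memF vs] := fin s; first by apply/memF => phi phis; apply: DG; rewrite Ds.
by exists v => phi; rewrite Ds => /vs.
Qed.

(** Saturation for countably many variables and no parameters. The set of all
    formulas over [nat] is small, and so is any set of renamed such formulas. *)
Lemma saturated_realizes (K : Type) (L : language) (U : structure L)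
    (V : countType) (G : set (formula L V)) :
  small K [set: formula L nat] -> saturated K U -> finsat U G ->
  exists v : V -> U, forall phi, G phi -> sat phi v.
Proof.
move=> Lsmall Usat fin.
pose code phi : formula L (nat + U) := rename phi (inl \o @pickle V).
have [||v vG] := @saturated_satisfiable K L U nat (code @` G) Usat.
- apply: small_card_le Lsmall.
  apply: card_le_trans (card_image_le (fun phi => rename phi inl) _).
  apply: subset_card_le => _ [phi _ <-].
  by exists (rename phi (@pickle V)) => //; rewrite rename_rename.
- move=> s sG.
  have [t tG st] : exists2 t, Forall G t & s = map code t.
    elim: s sG => [|eta s IH]; first by exists [::].
    move=> /Forall_cons_iff[[phi Gphi <-] /IH[t tG ->]].
    by exists (phi :: t) => //; constructor.
  have [u ut] := fin t tG; have [m0] := carrier_inhabited U.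
  exists (fun n => oapp u m0 (unpickle n)); rewrite st.
  apply/Forall_map; apply: Forall_impl ut => phi; rewrite /code sat_rename.
  by congr sat; apply/funext => x /=; rewrite pickleK.
- exists (v \o pickle) => phi Gphi.
  by have := vG _ (ex_intro2 _ _ phi Gphi erefl); rewrite sat_rename.
Qed.

(** This replaces the extraction of an indiscernible sequence by Ramsey's
    theorem: a realization of a maximal set of templates is indiscernible by
    [maximal_templates_complete]. *)
Lemma indiscernible_realization (K : Type) (L : language) (U : structure L)
    (k : nat) (S0 : set (template L k)) :
  small K [set: formula L nat] -> saturated K U ->
  finsat U (instances ltn S0) ->
  exists2 a : nat -> 'I_k -> U, indiscernible a &
    forall phi, instances ltn S0 phi -> sat phi (fun x => a x.1 x.2).
Proof.
move=> Lsmall Usat fin0.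
have [S [S0S finS maxS]] := maximal_finsat (@instances_witness L k nat ltn) fin0.
have [v vS] := saturated_realizes Lsmall Usat finS.
have vE : (fun x => v (x.1, x.2)) = v by apply/funext => -[].
exists (fun i r => v (i, r)); last first.
  by move=> phi [t /S0S St gP]; rewrite vE; apply: vS; exists t.
suff half n (theta : formula L ('I_n * 'I_k)) (i j : 'I_n -> nat) :
    increasing i -> increasing j ->
    sat theta (v \o at_places i) -> sat theta (v \o at_places j).
  by move=> n theta i j imon jmon; split; apply: half.
move=> imon jmon thetai.
have Stheta := maximal_templates_complete finS maxS vS imon thetai.
by rewrite -sat_rename; apply: vS; exists (existT _ n theta) => //; exists j.
Qed.

(** * Shattered sequences *)

(** That a cut [W] is realized by some [b] is a positive formula in the [x_j]
    alone. This is why cuts can be moved along indiscernible sequences and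
    reflected by immersions. *)
Definition shatters (L : language) (k l n : nat)
    (phi psi : formula L ('I_k + 'I_l)) (W : 'I_n -> bool) :
    formula L ('I_n * 'I_k) :=
  exists_block (conjunction
    [seq rename (if W j then phi else psi) (fun z =>
      match z with inl r => inl (j, r) | inr i => inr i end)
    | j : 'I_n]).

Lemma sat_shatters (L : language) (M : structure L) (k l n : nat)
    (phi psi : formula L ('I_k + 'I_l)) (W : 'I_n -> bool)
    (a : 'I_n * 'I_k -> M) :
  sat (shatters phi psi W) a <-> exists b : 'I_l -> M, forall j,
    sat (if W j then phi else psi) (join (fun r => a (j, r)) b).
Proof.
have memF (P : set (formula L (('I_n * 'I_k) + 'I_l))) (f : 'I_n -> _) :
    Forall P (codom f) <-> forall j, P (f j).
  rewrite codomE; split=> [|Pf].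
    move=> /Forall_map/List.Forall_forall => Pf j; apply: Pf.
    have := mem_enum 'I_n j; rewrite inE.
    by elim: (enum _) => //= i t IH; rewrite inE => /orP[/eqP->|/IH]; [left|right].
  by apply/Forall_map; elim: (enum _) => //= i t IH; constructor.
rewrite sat_exists_block; split=> -[b bP]; exists b.
  move=> j; move/sat_conjunction/memF: bP => /(_ j); rewrite sat_rename.
  by congr sat; apply/funext => -[].
apply/sat_conjunction/memF => j; rewrite sat_rename.
by move: (bP j); congr sat; apply/funext => -[].
Qed.

Definition shattering (L : language) (k l : nat)
    (phi psi : formula L ('I_k + 'I_l)) : set (template L k) :=
  [set t | exists (n : nat) (W : 'I_n -> bool),
     t = existT _ n (shatters phi psi W)].

(** Along a realization of [shattering], the finite cuts are all realized, so by
    saturation over the countably many parameters [a] also the infinite ones. *)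
Lemma shattering_parameter (K : Type) (L : language) (U : structure L)
    (k l : nat) (phi psi : formula L ('I_k + 'I_l))
    (a : nat -> 'I_k -> U) (W : nat -> bool) :
  small K [set: formula L nat] -> saturated K U ->
  (forall eta, instances ltn (shattering phi psi) eta ->
     sat eta (fun x => a x.1 x.2)) ->
  exists b : 'I_l -> U, forall j, sat (if W j then phi else psi) (join (a j) b).
Proof.
move=> Lsmall Usat aP.
pose lit j : formula L ('I_l + U) := rename (if W j then phi else psi)
  (fun z => match z with inl r => inr (a j r) | inr i => inl i end).
have satlit j b : sat (lit j) (join b id) =
    sat (if W j then phi else psi) (join (a j) b).
  by rewrite sat_rename; congr sat; apply/funext => -[].
have [||b bP] := @saturated_satisfiable K L U 'I_l (range lit) Usat.
- apply: small_card_le (small_nat Lsmall); exact: card_image_le.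
- move=> s sG.
  have [N sN] : exists N, Forall [set eta | exists2 j, j < N & lit j = eta] s.
    elim: s sG => [|eta s IH]; first by exists 0.
    move=> /Forall_cons_iff[[j _ <-] /IH[N sN]]; exists (maxn j.+1 N).
    constructor; first by exists j => //; rewrite leq_max ltnSn.
    by apply: Forall_impl sN => _ [i iN <-]; exists i => //; rewrite leq_max iN orbT.
  have := aP (rename (shatters phi psi (W \o @nat_of_ord N))
    (at_places (@nat_of_ord N))).
  rewrite sat_rename => /(_ _)/sat_shatters[|b bP].
    exists (existT _ N (shatters phi psi (W \o @nat_of_ord N))).
      by exists N, (W \o @nat_of_ord N).
    by exists (@nat_of_ord N).
  exists b; apply: Forall_impl sN => _ [j jN <-].
  by rewrite satlit; apply: (bP (Ordinal jN)).
- by exists b => j; rewrite -satlit; apply: bP; exists j.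
Qed.

(** * Shattering, IP and alternation *)

Lemma IP_of_shattered (K : Type) (L : language) (T : set (h_inductive L))
    (U : structure L) (k l : nat) (phi psi : formula L ('I_k + 'I_l)) :
  monster K T U -> finsat U (instances ltn (shattering phi psi)) ->
  has_IP T phi psi.
Proof.
move=> [Lsmall [UT _] _ Usat] fin.
have [a _ aP] := indiscernible_realization Lsmall Usat fin.
have /choice[b bP] (W : set nat) :=
  shattering_parameter (fun j => `[< W j >]) Lsmall Usat aP.
exists U; split=> //; exists a, b => i W.
by have := bP W i; case: asboolP.
Qed.

(** Finitely many instances are satisfiable together if and only if a formula
    without free variables holds. It passes from the model with IP to the common
    continuation, and from there back to [U], which is immersed in it. *)
Lemma shattered_of_IP (L : language) (T : set (h_inductive L))
    (U : structure L) (k l : nat) (phi psi : formula L ('I_k + 'I_l)) :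
  joint_continuation T -> pec T U -> has_IP T phi psi ->
  finsat U (instances ltn (shattering phi psi)).
Proof.
move=> JCP [UT Upec] [A [AT [a [b ab]]]] s sS.
have [N [f1 [f2 [NT f1hom f2hom]]]] := JCP U A UT AT.
have [_ f1imm] := Upec N f1 NT f1hom.
(* Projection to the empty set of variables yields a sentence. *)
have inj0 : injective (fun i : 'I_0 => False_rect (nat * 'I_k) (notF (ltn_ord i))).
  by move=> i; case: (notF (ltn_ord i)).
have [chi chiP] := projection_exists (conjunction s) inj0.
have fun0 (M : structure L) (u w : 'I_0 -> M) : u = w.
  by apply/funext => i; case: (notF (ltn_ord i)).
pose none (M : structure L) (i : 'I_0) := False_rect M (notF (ltn_ord i)).
have chiA : sat chi (none A).
  apply/chiP; exists (fun x => a x.1 x.2); first exact: fun0.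
  apply/sat_conjunction; apply: Forall_impl sS => _ [_ [n [W ->]] [g gmon ->]].
  rewrite sat_rename; apply/sat_shatters => /=.
  (* As [g] is injective, the image of [W] cuts the range of [g] as [W] does. *)
  exists (b [set m | exists2 j, g j = m & W j]) => j /=.
  have [inW ninW] := ab (g j) [set m | exists2 j, g j = m & W j].
  case: ifPn => [Wj|nWj]; first by apply: inW; exists j.
  apply: ninW => -[i gij Wi].
  suff ij : i = j by rewrite -ij Wi in nWj.
  by apply/val_inj; case: (ltngtP i j) => // /gmon /=; rewrite gij ltnn.
have := f2hom _ _ _ chiA.
rewrite (fun0 N (f2 \o none A) (f1 \o none U)) => /f1imm.
by move=> /chiP[u _ /sat_conjunction us]; exists u.
Qed.

Lemma enat_supP (S : set enat) (N : nat) :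
  enat_le (enat_sup S) (Fin N) <-> forall x, S x -> enat_le x (Fin N).
Proof.
rewrite /enat_sup; case: pselect => [bnd|nbnd]; last first.
  by split=> // SN; case: nbnd; exists N; apply/asboolP.
case: ex_minnP => m /asboolP Sm mmin; split=> [mN x /Sm|SN].
  by case: x => //= p pm; apply: leq_trans mN.
by apply: mmin; apply/asboolP.
Qed.

Lemma enat_infinite (x : enat) :
  x = Infty <-> forall N, ~ enat_le x (Fin N).
Proof. by case: x => // n; split=> // /(_ n); rewrite /= leqnn. Qed.

Lemma alt_infinite (L : language) (U : structure L) (k l : nat)
    (phi psi : formula L ('I_k + 'I_l)) :
  alt U phi psi = Infty <-> forall N, exists (a : nat -> 'I_k -> U) (b : 'I_l -> U),
    indiscernible a /\ exists2 n, N < n & alternations phi psi a b n.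
Proof.
rewrite enat_infinite; split=> H N.
  apply: contrapT => no; apply: (H N); apply/enat_supP => _ [a [b [ind ->]]].
  apply/enat_supP => _ [n altn <-] /=; rewrite leqNgt; apply/negP => Nn.
  by apply: no; exists a, b; split=> //; exists n.
move=> /enat_supP le; have [a [b [ind [n Nn altn]]]] := H N.
have /enat_supP /(_ (Fin n)) := le _ (ex_intro _ a (ex_intro _ b (conj ind erefl))).
by rewrite /= leqNgt Nn => /(_ _)/notF; apply; exists n.
Qed.

(** Among the indices [i (2j)] and [i (2j + 1)] of the [j]-th pair, one satisfies
    [phi] and the other [psi]; the cut [W] says which of them to take. *)
Lemma alternation_shatters (L : language) (U : structure L) (k l : nat)
    (phi psi : formula L ('I_k + 'I_l)) (a : nat -> 'I_k -> U) (b : 'I_l -> U)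
    (m n : nat) (W : 'I_n -> bool) (g : 'I_n -> nat) :
  indiscernible a -> alternations phi psi a b m -> n.*2 <= m ->
  increasing g ->
  sat (shatters phi psi W) (fun x => a (g x.1) x.2).
Proof.
move=> ind [i [imon ialt]] nm gmon.
have posP (j : 'I_n) : j.*2 + ~~ W j < m.+1.
  by have := ltn_ord j; case: (W j) => /=; lia.
pose pos j := i (Ordinal (posP j)).
have posmon : increasing pos.
  by move=> p q pq; apply: imon => /=; case: (W p); case: (W q); lia.
apply/(ind n _ pos g posmon gmon)/sat_shatters; exists b => j /=.
have [even odd] := ialt (Ordinal (posP j)).
move: even odd; rewrite /= oddD odd_double /= -/(pos j).
by case: (W j) => /= even odd; [apply: even|apply: odd].
Qed.

(** Finitely many instances of [shattering] hold along any indiscernible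
    sequence with enough alternations, where the bound depends on their
    widths only. *)
Lemma shattered_of_alt (L : language) (U : structure L) (k l : nat)
    (phi psi : formula L ('I_k + 'I_l)) :
  alt U phi psi = Infty -> finsat U (instances ltn (shattering phi psi)).
Proof.
move=> /alt_infinite unb s sS.
have [N NP] : exists N, forall (a : nat -> 'I_k -> U) (b : 'I_l -> U) m,
    indiscernible a -> alternations phi psi a b m -> N <= m ->
    Forall (fun eta => sat eta (fun x => a x.1 x.2)) s.
  elim: s sS => [|eta s IH] sS; first by exists 0.
  move/Forall_cons_iff: sS => [[_ [n [W ->]] [g gmon ->]] /IH[N NP]].
  exists (maxn n.*2 N) => a b m ind altm; rewrite geq_max => /andP[nm Nm].
  constructor; last exact: NP altm Nm.
  by rewrite sat_rename; apply: alternation_shatters ind altm nm gmon.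
have [a [b [ind [n Nn altn]]]] := unb N.
by exists (fun x => a x.1 x.2); apply: NP ind altn (ltnW Nn).
Qed.

Lemma alternating_of_shattered (K : Type) (L : language)
    (T : set (h_inductive L)) (U : structure L) (k l : nat)
    (phi psi : formula L ('I_k + 'I_l)) :
  monster K T U -> finsat U (instances ltn (shattering phi psi)) ->
  exists (a : nat -> 'I_k -> U) (b : 'I_l -> U),
    indiscernible a /\ forall n, alternations phi psi a b n.
Proof.
move=> [Lsmall _ _ Usat] fin.
have [a ind aP] := indiscernible_realization Lsmall Usat fin.
have [b bP] := shattering_parameter (fun j => ~~ odd j) Lsmall Usat aP.
exists a, b; split=> // n; exists (@nat_of_ord n.+1); split=> // j.
by have := bP j; case: (odd j).
Qed.

Theorem lemma6p24 (L : language) (T : set (h_inductive L))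
    (T_consistent : consistent T) (T_JCP : joint_continuation T)
    (K : Type) (U : structure L) (U_monster : monster K T U)
    (k l : nat) (phi psi : formula L ('I_k + 'I_l))
    (phi_psi : mutually_contradictory T phi psi) :
  (has_IP T phi psi <-> alt U phi psi = Infty) /\
  (has_IP T phi psi ->
   exists (a : nat -> 'I_k -> U) (b : 'I_l -> U),
     indiscernible a /\ alt_seq phi psi a b = Infty).
Proof.
have alternating : has_IP T phi psi -> exists (a : nat -> 'I_k -> U) (b : 'I_l -> U),
    indiscernible a /\ forall n, alternations phi psi a b n.
  have [_ Upec _ _] := U_monster.
  by move=> /(shattered_of_IP T_JCP Upec)/(alternating_of_shattered U_monster).
split; first split.
- move=> /alternating[a [b [ind ab]]]; apply/alt_infinite => N.
  by exists a, b; split=> //; exists N.+1.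
- by move=> /shattered_of_alt/(IP_of_shattered U_monster).
- move=> /alternating[a [b [ind ab]]]; exists a, b; split=> //.
  apply/enat_infinite => N /enat_supP /(_ (Fin N.+1)) /=; rewrite ltnn.
  by move=> /(_ (ex_intro2 _ _ N.+1 (ab _) erefl)).
Qed.
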